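(* Let $G=H\times K$ be a direct product of non-Dedekind groups $H$ and $K$. Then the graph $\vec\Delta_{\rm norm}(G)$ is strongly connected of diameter at most $3$ provided that one of the following conditions holds: (i) $\mathrm{Univ}(G)=\mathrm{Univ}(H)\times \mathrm{Univ}(K)$; (ii) for $h\in H$, $(h,1)\in \mathrm{Univ}(G)$ if and only if $h \in Z(H)$; (iii) for $k\in K$, $(1,k)\in \mathrm{Univ}(G)$ if and only if $k \in Z(K)$.
   Context: A group is Dedekind if all of its subgroups are normal (abelian groups are included). For a group $G$ and $x,y\in G$, write $x\to y$ if $\langle x\rangle$ is normal in $\langle x,y\rangle$ (equivalently, $y$ normalizes $\langle x\rangle$), and $x\leftrightarrow y$ if both $x\to y$ and $y\to x$. The directed normalizing graph $\vec\Gamma_{\rm norm}(G)$ is the simple directed graph with vertex set $G$ and with an arc from $x$ to $y$ ($x\neq y$) whenever $x\to y$. $\mathrm{Univ}(G)$ is the set of (bidirectional) universal vertices: those $x\in G$ with $x\leftrightarrow y$ for all $y\in G$. $\vec\Delta_{\rm norm}(G)$ is the induced subgraph of $\vec\Gamma_{\rm norm}(G)$ on $G\setminus\mathrm{Univ}(G)$. A directed graph is strongly connected if for every ordered pair of vertices $(u,v)$ there is a directed path from $u$ to $v$; its diameter is then the supremum, over ordered pairs of distinct vertices $(u,v)$, of the length of a shortest directed path from $u$ to $v$. $Z(\cdot)$ denotes the center. *)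

(* Defs.v *)
From HB Require Import structures.
From mathcomp Require Import all_boot all_order.
From mathcomp Require Import boolp classical_sets.

Set Implicit Arguments.
Unset Strict Implicit.
Unset Printing Implicit Defensive.

Local Open Scope classical_set_scope.
Local Open Scope group_scope.

(* Groups are arbitrary, possibly infinite, [groupType]s, so subgroups are
   [Prop]-valued sets and the finite-group notations of [fingroup] do not
   apply.  The direct product of [H] and [K] is [(H * K)%type] with its
   canonical, componentwise group structure. *)

Definition subgroup (G : groupType) (A : set G) : Prop := group_closed [in A].

Definition generated (G : groupType) (A : set G) : set G :=
  smallest (@subgroup G) A.

Definition normal_in (G : groupType) (N M : set G) : Prop :=
  [/\ subgroup N, subgroup M, N `<=` M
    & forall n m, N n -> M m -> N (n ^ m)].

Definition dedekind (G : groupType) : Prop :=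
  forall A : set G, subgroup A -> normal_in A [set: G].

Definition center (G : groupType) : set G :=
  [set z | forall x : G, commute z x].

Definition norm_to (G : groupType) (x y : G) : Prop :=
  normal_in (generated [set x]) (generated [set x; y]).

Definition Univ (G : groupType) : set G :=
  [set x | forall y : G, norm_to x y /\ norm_to y x].

Arguments center G : clear implicits.
Arguments Univ G : clear implicits.

Record digraph (T : Type) := Digraph {
  vertices : set T;
  arc : T -> T -> Prop;
  arc_vertices : forall x y, arc x y -> vertices x /\ vertices y;
  arc_neq : forall x y, arc x y -> x <> y
}.

Definition induced (T : Type) (D : digraph T) (A : set T) : digraph T.
Proof.
apply: (@Digraph T (vertices D `&` A) (fun x y => [/\ arc D x y, A x & A y])).
- by move=> x y [/(@arc_vertices T D) [Dx Dy] Ax Ay].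
- by move=> x y [/(@arc_neq T D)].
Defined.

Definition norm_digraph (G : groupType) : digraph G.
Proof.
apply: (@Digraph G [set: G] (fun x y => x <> y /\ norm_to x y)).
- by [].
- by move=> x y [].
Defined.

Definition reduced_norm_digraph (G : groupType) : digraph G :=
  induced (norm_digraph G) (~` Univ G).

(* [p] lists the vertices after the start [u], so its size is the number of
   arcs; [p = [::]] is the trivial path, allowed when [u = v]. *)
Definition dipath (T : eqType) (D : digraph T) (u v : T) (p : seq T) : Prop :=
  [/\ vertices D u, path (fun x y => `[< arc D x y >]) u p,
      last u p = v & uniq (u :: p)].

Definition strongly_connected (T : eqType) (D : digraph T) : Prop :=
  forall u v, vertices D u -> vertices D v -> exists p, dipath D u v p.

Definition is_distance (T : eqType) (D : digraph T) (u v : T) (n : nat) : Prop :=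
  (exists2 p, dipath D u v p & size p = n) /\
  (forall p, dipath D u v p -> (n <= size p)%N).

Definition distances (T : eqType) (D : digraph T) : set nat :=
  [set n | exists u v, [/\ vertices D u, vertices D v, u <> v
                         & is_distance D u v n]].

(* Only meaningful for strongly connected [D], as pairs without a path
   between them contribute no distance.  The supremum is taken in [nat], so
   an infinite diameter is the absence of any [d] with [is_diameter D d], and
   the supremum of no distances at all is [0]. *)
Definition is_diameter (T : eqType) (D : digraph T) (d : nat) : Prop :=
  supremums (distances D) d.

(* Main.v *)
(** Since [y] normalizes [<x>] as soon as [y] is a product of elements that do,
    and commuting elements are joined by arcs both ways, a vertex [(h1, k1)]
    reaches [(h2, k2)] through [(h1, 1)] and [(1, k2)], or through [(1, k1)]
    and [(h2, 1)], whenever these are not universal.  If [(1, k2)] is universal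
    it can be replaced by any nonuniversal [(1, k)], which exists because [K] is
    not Dedekind; likewise for [(h2, 1)].  There remain the vertices that are
    products of two universal elements.  Everything has an arc into such a
    vertex.  Condition (i) excludes them, while (ii) makes [h1] central, so that
    [(h1, k1)] has an arc to every [(h, 1)]; (iii) is symmetric. *)

Require Import Defs.
From mathcomp Require Import all_boot all_order.
From mathcomp Require Import boolp classical_sets.

Local Open Scope classical_set_scope.
Local Open Scope group_scope.

Section Generated.

Variable G : groupType.
Implicit Types (A B : set G) (x y z : G).

Lemma subgroupP A :
  subgroup A <-> A 1 /\ (forall x y, A x -> A y -> A (x * y^-1)).
Proof.
split=> [[A1 AB]|[A1 AB]]; split; rewrite ?inE // in A1 *.
- by move=> x y Ax Ay; have := AB x y; rewrite !inE; apply.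
- by move=> x y; rewrite !inE; apply: AB.
Qed.

Lemma subgroup1 A : subgroup A -> A 1.
Proof. by case/subgroupP. Qed.

Lemma subgroupV A x : subgroup A -> A x -> A x^-1.
Proof. by case/subgroupP=> A1 AB Ax; rewrite -[x^-1]mul1g; apply: AB. Qed.

Lemma subgroupM A x y : subgroup A -> A x -> A y -> A (x * y).
Proof.
move=> sgA Ax Ay; rewrite -[y]invgK; case/subgroupP: (sgA) => _; apply=> //.
exact: subgroupV.
Qed.

Lemma generated_subgroup A : subgroup (generated A).
Proof.
apply/subgroupP; split=> [B [sgB _]|x y Ax Ay B AB]; first exact: subgroup1.
have [sgB _] := AB.
by apply: subgroupM => //; [exact: Ax | apply: subgroupV => //; exact: Ay].
Qed.

Lemma generated1 x : generated [set x] x.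
Proof. exact: sub_gen_smallest. Qed.

Lemma generated1_min x A : subgroup A -> A x -> generated [set x] `<=` A.
Proof. by move=> sgA Ax; apply: smallest_sub => // _ ->. Qed.

Lemma subgroup_conj A y : subgroup A -> subgroup [set x | A (x ^ y)].
Proof.
move=> sgA; apply/subgroupP; split=> /=.
  by rewrite conj1g; apply: subgroup1.
move=> x z Ax Az; rewrite conjMg conjVg.
by apply: subgroupM => //; apply: subgroupV => //.
Qed.

(** In an infinite group conjugation by [y] may map [<x>] onto a proper subgroup of itself, hence
    the condition on [y^-1] as well. *)
Lemma norm_toP x y :
  norm_to x y <->
  generated [set x] (x ^ y) /\ generated [set x] (x ^ y^-1).
Proof.
set X := generated [set x]; have sgX : subgroup X := generated_subgroup _.
split=> [[_ sgXY _ nX]|[Xxy Xxy']].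
  have XYy : generated [set x; y] y by apply: sub_gen_smallest; right.
  split; apply: nX; try exact: generated1; first exact: XYy.
  exact: (subgroupV _ _ sgXY).
(* The normalizer of [X]. It is a subgroup, so it contains [<x, y>] as soon as it contains [x] and
   [y]. *)
pose N := [set m | forall n, X n -> X (n ^ m) /\ X (n ^ m^-1)].
have sgN : subgroup N.
  apply/subgroupP; split=> [n|a b Na Nb n Xn]; first by rewrite invg1 conjg1.
  rewrite invgM invgK !conjgM; split.
    exact: (Nb _ (Na _ Xn).1).2.
  exact: (Na _ (Nb _ Xn).1).2.
(* Conjugation is a homomorphism, so the image of the generator decides. *)
have X_conj a n : X (x ^ a) -> X n -> X (n ^ a).
  move=> Xa; apply: (generated1_min _ [set z | X (z ^ a)]) => //.
  exact: subgroup_conj.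
have N_gen m : X (x ^ m) -> X (x ^ m^-1) -> N m.
  by move=> Xm Xm' n Xn; split; apply: X_conj.
have sXN : generated [set x; y] `<=` N.
  apply: smallest_sub => // _ [] ->; apply: N_gen => //;
  by rewrite conjgE ?mulVg ?mulgV ?mulg1 ?mulKg ?mulgK ?invgK; apply: generated1.
split=> //; first exact: generated_subgroup.
  apply: generated1_min; first exact: generated_subgroup.
  by apply: sub_gen_smallest; left.
by move=> n m Xn XYm; have [] := sXN _ XYm n Xn.
Qed.

Lemma norm_to_generated x y z :
  norm_to x y -> generated [set x] z -> generated [set x] (z ^ y).
Proof.
by case=> _ _ _ nX Xz; apply: nX => //; apply: sub_gen_smallest; right.
Qed.

Lemma norm_toV x y : norm_to x y -> norm_to x y^-1.
Proof. by move/norm_toP=> [? ?]; apply/norm_toP; rewrite invgK. Qed.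

Lemma norm_toM x y z : norm_to x y -> norm_to x z -> norm_to x (y * z).
Proof.
move=> xy xz; apply/norm_toP; rewrite invgM !conjgM.
have [[xxy _] [_ xxz']] := (proj1 (norm_toP _ _) xy, proj1 (norm_toP _ _) xz).
by split; apply: norm_to_generated => //; apply: norm_toV.
Qed.

Lemma commute_norm_to x y : commute x y -> norm_to x y.
Proof.
move=> cxy; have cxy' := commuteV cxy.
by apply/norm_toP; split; rewrite conjgE ?cxy ?cxy' ?mulKg;
  apply: generated1.
Qed.

End Generated.

(** The preimage of [<f x>] is a subgroup containing [x], so [f] maps [<x>] into [<f x>]. *)
Lemma norm_to_morph (G L : groupType) (f : UMagmaMorphism.type G L) (x y : G) :
  norm_to x y -> norm_to (f x) (f y).
Proof.
have sub_f z : generated [set x] z -> generated [set f x] (f z).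
  move: z; apply: (generated1_min _ _ (f @^-1` generated [set f x])).
    have sgX := @generated_subgroup _ [set f x].
    apply/subgroupP; split=> [|a b Xa Xb] /=.
      by rewrite gmulf1; apply: subgroup1.
    by rewrite gmulfM gmulfV; case/subgroupP: sgX => _; apply.
  exact: generated1.
move=> /norm_toP[Xxy Xxy']; apply/norm_toP.
by rewrite -gmulfV -!gmulfJ; split; apply: sub_f.
Qed.

(** A subgroup is the union of its cyclic subgroups, so normality of these suffices. *)
Lemma norm_to_dedekind (G : groupType) :
  (forall x y : G, norm_to x y) -> dedekind G.
Proof.
move=> nG A sgA; split=> //.
  by apply/subgroupP; split.
move=> x y Ax _; have /norm_toP[Xxy _] := nG x y.
exact: (generated1_min _ x A sgA Ax _ Xxy).
Qed.

(** If every [s l] were universal, pushing the relations between them along [f] would make [L]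
    Dedekind. Serves for the projections of a product and the embeddings of its factors. *)
Lemma not_dedekind_section (G L : groupType) (f : UMagmaMorphism.type G L)
    (s : L -> G) :
  cancel s f -> ~ dedekind L -> exists l, ~ Univ G (s l).
Proof.
move=> sK nL; apply/existsNP => uL; apply: nL; apply: norm_to_dedekind => x y.
by rewrite -(sK x) -(sK y); apply: norm_to_morph; apply: (uL x _).1.
Qed.

Section Walks.

Variables (T : eqType) (D : digraph T).
Let e x y := `[< Defs.arc D x y >].

(** Repeated neighbours are allowed, so that a walk of fixed length can be given without checking
    which vertices coincide. Repetitions are dropped first, then cycles are cut out. *)
Lemma walk_dipath u p :
  vertices D u -> path (fun x y => (x == y) || e x y) u p ->
  exists2 q, dipath D u (last u p) q & (size q <= size p)%N.
Proof.
move=> Du up.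
have [q [uq <- szq]] :
    exists q, [/\ path e u q, last u q = last u p & (size q <= size p)%N].
  elim: p u {Du} up => [|x p IHp] u /=; first by exists [::].
  move=> /andP[ux /IHp[q [xq lq szq]]].
  case/orP: ux => [/eqP->|eux]; last by exists (x :: q); rewrite /= eux.
  by exists q; split=> //; apply: leqW.
case/shortenP: uq szq => r ur Ur sr szq.
exists r; first by split.
by apply: leq_trans szq; apply: uniq_leq_size => //; case/andP: Ur.
Qed.

(** The distances are bounded by [n], so they have a supremum in [nat], which as least upper bound
    is at most [n]. *)
Lemma bounded_diameter n :
  (forall u v, vertices D u -> vertices D v ->
     exists2 p, dipath D u v p & (size p <= n)%N) ->
  strongly_connected D /\ (exists2 d, is_diameter D d & (d <= n)%N).
Proof.
move=> Dn; split=> [u v Du Dv|]; first by have [p] := Dn u v Du Dv; exists p.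
have ubn : ubound (distances D) n.
  move=> m [u [v [Du Dv _ [_ minm]]]]; have [p uvp szp] := Dn u v Du Dv.
  exact: leq_trans (minm p uvp) szp.
have [|d dD] := @nat_supremums_neq0 (distances D); first by exists n.
by exists d => //; apply: dD.2.
Qed.

End Walks.

Section CommutingFactors.

Variables (G : groupType) (A B : set G).

Hypothesis cAB : forall a b, A a -> B b -> commute a b.

(** Stated for two commuting sets, so that exchanging them serves condition (iii). The third premise
    is what the conditions supply: it is vacuous under (i) and follows from centrality under
    (ii). *)
Lemma commuting_factors_walk :
  (exists2 a, A a & ~ Univ G a) -> (exists2 b, B b & ~ Univ G b) ->
  (forall a b, A a -> B b -> Univ G a -> Univ G b -> ~ Univ G (a * b) ->
     forall a', A a' -> commute a a') ->
  forall a1 b1 a2 b2, A a1 -> B b1 -> A a2 -> B b2 ->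
  ~ Univ G (a1 * b1) -> ~ Univ G (a2 * b2) ->
  exists x y, [/\ ~ Univ G x, ~ Univ G y, norm_to (a1 * b1) x, norm_to x y
                & norm_to y (a2 * b2)].
Proof.
move=> [a0 Aa0 Ua0] [b0 Bb0 Ub0] cA a1 b1 a2 b2 Aa1 Bb1 Aa2 Bb2 U1 U2.
have nab a b : A a -> B b -> norm_to a b.
  by move=> Aa Bb; apply: commute_norm_to; apply: cAB.
have nba a b : A a -> B b -> norm_to b a.
  by move=> Aa Bb; apply: commute_norm_to; apply: commute_sym; apply: cAB.
have cAM a a' b : A a' -> B b -> commute a a' -> norm_to (a * b) a'.
  move=> Aa' Bb caa'; apply: commute_norm_to; apply: commute_sym.
  by apply: commuteM; [exact: commute_sym | exact: cAB].
have cBM a b b' : A a -> B b' -> commute b b' -> norm_to (a * b) b'.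
  move=> Aa Bb' cbb'; apply: commute_norm_to; apply: commute_sym.
  by apply: commuteM; apply: commute_sym => //; apply: cAB.
have norm_aM a a' b : A a -> B b -> norm_to a a' -> norm_to a (a' * b).
  by move=> Aa Bb aa'; apply: norm_toM => //; apply: nab.
have norm_bM a b b' : A a -> B b -> norm_to b b' -> norm_to b (a * b').
  by move=> Aa Bb bb'; apply: norm_toM => //; apply: nba.
(* The start has an arc straight to the target; the walk is padded by repeating the start. *)
have [Uab2|_] := pselect (Univ G a2 /\ Univ G b2).
  exists (a1 * b1), (a1 * b1); split=> //; try exact: commute_norm_to.
  by apply: norm_toM; [apply: (Uab2.1 _).2 | apply: (Uab2.2 _).2].
(* When [b2] is universal, [b0] replaces it, since [norm_to b0 b2] holds. *)
have to_b2 : exists b, [/\ B b, ~ Univ G b & norm_to b (a2 * b2)].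
  have [Ub2|Ub2] := pselect (Univ G b2).
    by exists b0; split=> //; apply: norm_bM => //; apply: (Ub2 _).2.
  by exists b2; split=> //; apply: norm_bM => //; apply: commute_norm_to.
have to_a2 : exists a, [/\ A a, ~ Univ G a & norm_to a (a2 * b2)].
  have [Ua2|Ua2] := pselect (Univ G a2).
    by exists a0; split=> //; apply: norm_aM => //; apply: (Ua2 _).2.
  by exists a2; split=> //; apply: norm_aM => //; apply: commute_norm_to.
have from_a a : A a -> ~ Univ G a -> norm_to (a1 * b1) a ->
    exists x y, [/\ ~ Univ G x, ~ Univ G y, norm_to (a1 * b1) x, norm_to x y
                  & norm_to y (a2 * b2)].
  move=> Aa Ua na; have [b [Bb Ub nb]] := to_b2.
  by exists a, b; split=> //; apply: nab.
have [Ua1|Ua1] := pselect (Univ G a1); last first.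
  by apply: (from_a a1) => //; apply: cAM.
(* With both factors universal, the third premise makes [a1] commute with [a0], so the walk can
   start towards [a0]. *)
have [Ub1|Ub1] := pselect (Univ G b1).
  by apply: (from_a a0) => //; apply: cAM => //; apply: (cA a1 b1).
(* Only [b1] is not universal: the mirror route, through [B] and then [A]. *)
have [a [Aa Ua na]] := to_a2.
by exists b1, a; split=> //; [apply: cBM | apply: nba].
Qed.

End CommutingFactors.

Theorem theoremA (H K : groupType) :
  ~ dedekind H -> ~ dedekind K ->
  [\/ Univ ((H * K)%type : groupType) = Univ H `*` Univ K,
      (forall h : H, Univ ((H * K)%type : groupType) (h, 1) <-> center H h)
    | (forall k : K, Univ ((H * K)%type : groupType) (1, k) <-> center K k)] ->
  strongly_connected (reduced_norm_digraph ((H * K)%type : groupType)) /\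
  (exists2 d : nat, is_diameter (reduced_norm_digraph ((H * K)%type : groupType)) d
                  & (d <= 3)%N).
Proof.
move=> ndH ndK cond; set G := ((H * K)%type : groupType) in cond *.
pose A : set G := [set g | g.2 = 1]; pose B : set G := [set g | g.1 = 1].
have cAB a b : A a -> B b -> commute a b.
  case: a b => [a1 a2] [b1 b2]; rewrite /A /B /= => -> ->.
  by rewrite /commute /mul /= /mul_pair /= !mulg1 !mul1g.
have [h0 Uh0] :=
  @not_dedekind_section G H fst (fun h => (h, 1)) (fun=> erefl) ndH.
have [k0 Uk0] :=
  @not_dedekind_section G K snd (fun k => (1, k)) (fun=> erefl) ndK.
have exA : exists2 a, A a & ~ Univ G a by exists (h0, 1).
have exB : exists2 b, B b & ~ Univ G b by exists (1, k0).
have prodE (h : H) (k : K) : (h, k) = (h, 1) * (1, k) :> G.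
  by rewrite /mul /= /mul_pair /= mulg1 mul1g.
apply: bounded_diameter => u v [_ Uu] [_ Uv].
suff [x [y [Ux Uy ux xy yv]]] : exists x y,
    [/\ ~ Univ G x, ~ Univ G y, norm_to u x, norm_to x y & norm_to y v].
  have step (a b : G) : ~ Univ G a -> ~ Univ G b -> norm_to a b ->
      (a == b) || `[< Defs.arc (reduced_norm_digraph G) a b >].
    by move=> Ua Ub ab; have [//|/eqP neq] := eqVneq a b; apply/asboolP.
  apply: (@walk_dipath _ (reduced_norm_digraph G) u [:: x; y; v]) => //=.
  by rewrite !step.
case: u v Uu Uv => [h1 k1] [h2 k2]; rewrite /setC /=.
rewrite (prodE h1 k1) (prodE h2 k2); case: cond => [UG|UH|UK].
(* Under (i), universality of [(h, 1)] and [(1, k)] forces that of [(h, k)], a contradiction. *)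
- apply: (commuting_factors_walk _ _ _ cAB) => //.
  move=> [h ?] [? k]; rewrite /A /B /= => -> -> + + U.
  rewrite UG => -[/= Uh _] [_ /= Uk].
  by case: U; rewrite -prodE UG.
- apply: (commuting_factors_walk _ _ _ cAB) => //.
  move=> [h ?] b; rewrite /A /= => -> _ /UH ch _ _ [h' ?] /= ->.
  by rewrite /commute /mul /= /mul_pair /= ch.
(* Under (iii) the factors exchange roles, each vertex being rewritten as an element of [B] times
   one of [A]. *)
have cBA b a : B b -> A a -> commute b a.
  by move=> Bb Aa; apply: commute_sym; apply: cAB.
rewrite (cAB (h1, 1) (1, k1)) // (cAB (h2, 1) (1, k2)) //.
apply: (commuting_factors_walk _ _ _ cBA) => //.
move=> [? k] a; rewrite /B /= => -> _ /UK ck _ _ [? k'] /= ->.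
by rewrite /commute /mul /= /mul_pair /= ck.
Qed.
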